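(* The algebra $\mathcal B=\mathcal O(\mathrm{SP}^\sigma(2))[A^{-1},B^{-1},C^{-1},D^{-1}]$ is isomorphic, as an algebra with anti-involution, to the noncommutative cluster algebra associated to a square after specializing the variables $X_{12}=X_{21}=X_{34}=X_{43}=1$, under the $\sigma$-algebra map sending $A\mapsto X_{13}$, $B\mapsto X_{14}$, $C\mapsto X_{23}$, $D\mapsto X_{24}$.
   Context: All algebras are associative unital $\mathbb Q$-algebras with a $\mathbb Q$-linear anti-involution $\sigma$; a $\sigma$-algebra map is an algebra homomorphism commuting with $\sigma$. $\mathcal O(\mathrm{SP}^\sigma(2))$ is the algebra generated by $A,B,C,D,\hat A,\hat B,\hat C,\hat D$ with $\sigma$ swapping $x\leftrightarrow\hat x$ for each generator, modulo the two-sided $\sigma$-stable ideal generated by the relations $\hat AC=\hat CA$, $A\hat B=B\hat A$, $\hat BD=\hat DB$, $C\hat D=D\hat C$, $\hat AD-\hat CB=1$, $A\hat D-B\hat C=1$. The algebra $\mathcal B$ is obtained by universally adjoining two-sided inverses of $A,B,C,D$ (and hence, applying $\sigma$, of $\hat A,\hat B,\hat C,\hat D$). The noncommutative cluster algebra associated to a square (a disk with four marked points $1,2,3,4$ in cyclic order): it is generated by invertible variables $X_{ij}$ (and their inverses) for ordered pairs $i\neq j$ in $\{1,2,3,4\}$ (one for each orientation of each side or diagonal), with $\sigma(X_{ij})=X_{ji}$. For a triangle with vertices $i,j,k$ the noncommutative angle is $T_i^{jk}=X_{ji}^{-1}X_{jk}X_{ik}^{-1}$. The relations are the triangle conditions $T_i^{jk}=T_i^{kj}$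 for all distinct $i,j,k$, and the mutation (exchange) relations $X_{jl}=X_{jk}X_{ik}^{-1}X_{il}+X_{ji}X_{ki}^{-1}X_{kl}$ for $(i,j,k,l)$ any cyclic rotation of $(1,2,3,4)$. *)

(* Defs.v *)
From HB Require Import structures.
From mathcomp Require Import all_boot all_order all_algebra.
From mathcomp Require Import generic_quotient ring_quotient.
From mathcomp Require Import finmap monalg boolp.

Set Implicit Arguments.
Unset Strict Implicit.
Unset Printing Implicit Defensive.

Import GRing.Theory.
Local Open Scope ring_scope.
Local Open Scope quotient_scope.

HB.mixin Record isSigmaAlgebra A of GRing.Algebra rat A := {
  sigma : A -> A;
  sigma_is_linear : linear sigma;
  sigmaM : forall x y, sigma (x * y) = sigma y * sigma x;
  sigmaK : involutive sigma
}.

#[short(type="sigmaAlgType")]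
HB.structure Definition SigmaAlgebra :=
  {A of GRing.Algebra rat A & isSigmaAlgebra A}.

HB.instance Definition _ (A : sigmaAlgType) :=
  GRing.isLinear.Build rat A A *:%R (@sigma A) (@sigma_is_linear A).

HB.mixin Record hasBar G of Choice G := {
  bar : G -> G;
  barK : involutive bar
}.

#[short(type="involType")]
HB.structure Definition Invol := {G of Choice G & hasBar G}.

(* The free associative algebra on G, with the anti-involution that reverses
   words and applies [bar] to every letter.  It is the monoid algebra of
   monalg, with locked operations: conversion would otherwise expand them. *)
HB.lock Definition free_mul (G : choiceType) (x y : {malg rat[{fmonom G}]}) :
  {malg rat[{fmonom G}]} := x * y.

HB.lock Definition free_gen (G : choiceType) (g : G) : {malg rat[{fmonom G}]} :=
  << fmu g >>.

Definition word_bar (G : involType) (m : {fmonom G}) : {fmonom G} :=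
  FMonom (rev (map bar (fmonom_val m))).

HB.lock Definition free_sigma (G : involType) (x : {malg rat[{fmonom G}]}) :
  {malg rat[{fmonom G}]} := \sum_(m <- msupp x) << x@_m *g word_bar m >>.

Section FreeSigmaAlgebra.
Variable G : involType.

Definition free_alg : Type := {malg rat[{fmonom G}]}.

HB.instance Definition _ := GRing.Lmodule.on free_alg.

Implicit Types (q : rat) (x y : free_alg) (m : {fmonom G}).

Lemma free_mulA : associative (@free_mul G).
Proof. by move=> x y z; rewrite free_mul.unlock mulrA. Qed.

Lemma free_mul1l : left_id 1 (@free_mul G).
Proof. by move=> x; rewrite free_mul.unlock mul1r. Qed.

Lemma free_mul1r : right_id 1 (@free_mul G).
Proof. by move=> x; rewrite free_mul.unlock mulr1. Qed.

Lemma free_mulDl : left_distributive (@free_mul G) +%R.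
Proof. by move=> x y z; rewrite free_mul.unlock mulrDl. Qed.

Lemma free_mulDr : right_distributive (@free_mul G) +%R.
Proof. by move=> x y z; rewrite free_mul.unlock mulrDr. Qed.

HB.instance Definition _ := GRing.Zmodule_isNzRing.Build free_alg
  free_mulA free_mul1l free_mul1r free_mulDl free_mulDr (oner_neq0 _).

Lemma free_mulE x y : x * y = @GRing.mul {malg rat[{fmonom G}]} x y.
Proof. by rewrite -[LHS]/(free_mul x y) free_mul.unlock. Qed.

Lemma free_scaleAl q x y : q *: (x * y) = @GRing.mul free_alg (q *: x) y.
Proof. by rewrite !free_mulE scalerAl. Qed.

HB.instance Definition _ :=
  GRing.Lmodule_isLalgebra.Build rat free_alg free_scaleAl.

Lemma free_scaleAr q x y : q *: (x * y) = @GRing.mul free_alg x (q *: y).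
Proof.
rewrite !free_mulE -[q *: _]mul_malgC -[q *: y]mul_malgC [LHS]mulrA [RHS]mulrA.
apply: (congr1 (fun z => @GRing.mul {malg rat[{fmonom G}]} z y)).
rewrite !malgM_def fgmulUg fgmulgU; apply: eq_bigr => k _.
by rewrite mulrC mul1m mulm1.
Qed.

HB.instance Definition _ :=
  GRing.Lalgebra_isAlgebra.Build rat free_alg free_scaleAr.

Definition gen (g : G) : free_alg := free_gen g.

Lemma word_barM (m1 m2 : {fmonom G}) :
  word_bar (mmul m1 m2) = mmul (word_bar m2) (word_bar m1).
Proof.
by rewrite /word_bar /mmul /= !fmmulE /= map_cat rev_cat.
Qed.

Lemma word_barK : involutive (@word_bar G).
Proof.
case=> s; rewrite /word_bar /= map_rev revK -map_comp.
by congr FMonom; rewrite map_id_in // => g _; rewrite /= barK.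
Qed.

Lemma free_sigmaEw (d : {fset {fmonom G}}) x : fsubset (msupp x) d ->
  free_sigma x = \sum_(m <- d) << x@_m *g word_bar m >>.
Proof.
move=> le; rewrite free_sigma.unlock (big_fset_incl _ le) //= => m _ /mcoeff_outdom ->.
exact: monalgU0.
Qed.

Lemma free_sigmaU q m : free_sigma << q *g m >> = << q *g word_bar m >>.
Proof. by rewrite (free_sigmaEw msuppU_le) big_seq_fset1 mcoeffUU. Qed.

Lemma free_sigma_is_linear : linear (@free_sigma G : free_alg -> free_alg).
Proof.
move=> q x y.
have lexy : fsubset (msupp (q *: x + y)) (fsetU (msupp x) (msupp y)).
  apply: fsubset_trans (msuppD_le _ _) _.
  exact: fsetSU (msuppZ_le _ _).
rewrite (free_sigmaEw lexy) (free_sigmaEw (fsubsetUl _ (msupp y))).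
rewrite (free_sigmaEw (fsubsetUr (msupp x) _)) scaler_sumr -big_split /=.
apply: eq_bigr => m _; rewrite mcoeffD mcoeffZ monalgUD; congr (_ + _).
by rewrite -[in RHS]mul_malgC malgM_def fgmulUU mul1m.
Qed.

HB.instance Definition _ :=
  GRing.isLinear.Build rat free_alg free_alg *:%R (@free_sigma G)
    free_sigma_is_linear.

Lemma free_sigmaM x y :
  free_sigma (x * y) = @GRing.mul free_alg (free_sigma y) (free_sigma x).
Proof.
have E (z : free_alg) : free_sigma z = \sum_(m <- msupp z) << z@_m *g word_bar m >>.
  by rewrite free_sigma.unlock.
rewrite !free_mulE malgME (E x) (E y).
rewrite (linear_sum (@free_sigma G : free_alg -> free_alg)) /= mulr_sumr.
apply: eq_bigr => k _.
rewrite (linear_sum (@free_sigma G : free_alg -> free_alg)) /= mulr_suml.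
apply: eq_bigr => l _.
by rewrite free_sigmaU malgM_def fgmulUU word_barM mulrC.
Qed.

Lemma free_sigmaK : involutive (@free_sigma G).
Proof.
move=> x; rewrite {2}free_sigma.unlock [RHS]monalgE.
rewrite (linear_sum (@free_sigma G : free_alg -> free_alg)) /=.
by apply: eq_bigr => m _; rewrite /= free_sigmaU word_barK.
Qed.

HB.instance Definition _ := isSigmaAlgebra.Build free_alg
  free_sigma_is_linear free_sigmaM free_sigmaK.

Lemma sigma_gen (g : G) : sigma (gen g) = gen (bar g).
Proof.
rewrite /sigma /= /gen free_gen.unlock free_sigmaU.
by congr mkmalgU; rewrite /word_bar !fmuE.
Qed.

End FreeSigmaAlgebra.

Section FreeLift.
Variables (G : involType) (B : algType rat) (v : G -> B).

Definition word_val (m : {fmonom G}) : B := \prod_(g <- fmonom_val m) v g.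

Lemma word_val_mmorphism : mmorphism word_val.
Proof.
split; last by rewrite /word_val fm1 big_nil.
by move=> x y; rewrite /word_val /mmul /= fmmulE big_cat.
Qed.

HB.instance Definition _ :=
  monalg.isMultiplicative.Build {fmonom G} B word_val word_val_mmorphism.

Definition free_lift (x : free_alg G) : B := mmap (in_alg B) word_val x.

Lemma free_lift_is_zmod_morphism : zmod_morphism free_lift.
Proof. exact: (raddfB (mmap (in_alg B) word_val)). Qed.

HB.instance Definition _ :=
  GRing.isZmodMorphism.Build (free_alg G) B free_lift free_lift_is_zmod_morphism.

Lemma free_lift_is_monoid_morphism : monoid_morphism free_lift.
Proof.
have [|fM f1] := @commr_mmap_is_multiplicative _ _ _ (in_alg B) word_val.
  by move=> g m m'; rewrite /GRing.comm mulr_algl mulr_algr.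
by split=> // x y; rewrite free_mulE; exact: fM.
Qed.

HB.instance Definition _ := GRing.isMonoidMorphism.Build (free_alg G) B free_lift
  free_lift_is_monoid_morphism.

Lemma free_lift_is_scalable : scalable free_lift.
Proof. exact/rat_linear/free_lift_is_zmod_morphism. Qed.

HB.instance Definition _ :=
  GRing.isScalable.Build rat (free_alg G) B *:%R free_lift free_lift_is_scalable.

Lemma free_lift_gen g : free_lift (gen g) = v g.
Proof.
rewrite /gen free_gen.unlock /free_lift mmapU /= scale1r mul1r.
by rewrite /word_val fmuE big_seq1.
Qed.

End FreeLift.

Section SigmaQuotient.
Variables (A : sigmaAlgType) (R : A -> A -> Prop).

(* Closure under scalars is automatic, as [q *: x = q%:A * x]. *)
Record sigma_ideal (I : A -> Prop) : Prop := SigmaIdeal {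
  sideal0 : I 0;
  sidealB : forall x y, I x -> I y -> I (x - y);
  sidealMl : forall a x, I x -> I (a * x);
  sidealMr : forall a x, I x -> I (x * a);
  sideal_sigma : forall x, I x -> I (sigma x)
}.

(* The two-sided sigma-stable ideal generated by the elements [a - b], for all
   relations [R a b]. *)
Definition rel_ideal : pred A := fun x =>
  `[< forall I : A -> Prop, sigma_ideal I ->
        (forall a b, R a b -> I (a - b)) -> I x >].

Lemma rel_idealP : sigma_ideal (fun x => x \in rel_ideal).
Proof.
split=> [|x y /asboolP Ix /asboolP Iy|a x /asboolP Ix|a x /asboolP Ix
        |x /asboolP Ix]; apply/asboolP => I II RI; case: (II) => I0 IB IMl IMr Is.
- exact: I0.
- exact: IB (Ix I II RI) (Iy I II RI).
- exact: IMl (Ix I II RI).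
- exact: IMr (Ix I II RI).
- exact: Is (Ix I II RI).
Qed.

Lemma rel_ideal_rel a b : R a b -> a - b \in rel_ideal.
Proof. by move=> Rab; apply/asboolP => I _; apply. Qed.

Lemma rel_ideal_zmod : zmod_closed rel_ideal.
Proof. by split; [exact: sideal0 rel_idealP | exact: sidealB rel_idealP]. Qed.

HB.instance Definition _ := GRing.isZmodClosed.Build A rel_ideal rel_ideal_zmod.

Definition consistent : Prop := 1 \notin rel_ideal.

(* [algType] requires 1 != 0, whence the (proof-irrelevant) parameter. *)
Definition sigma_quot (_ : consistent) : Type :=
  Quotient.quot (GRing.ZmodClosed.clone A rel_ideal _).

Variable c : consistent.
Local Notation Q := (sigma_quot c).

HB.instance Definition _ := GRing.Zmodule.on Q.
HB.instance Definition _ := EqQuotient.on Q.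

Definition sproj (x : A) : Q := \pi_Q x.

Lemma sprojP x y : sproj x = sproj y <-> x - y \in rel_ideal.
Proof.
have E := Quotient.idealrBE (GRing.ZmodClosed.clone A rel_ideal _) x y.
by split=> [/eqP|]; [rewrite -[_ == _]E | move=> xy; apply/eqP; rewrite -[_ == _]E].
Qed.

Lemma sproj_rel a b : R a b -> sproj a = sproj b.
Proof. by move=> /rel_ideal_rel/sprojP. Qed.

Lemma sprojK (x : Q) : sproj (repr x) = x.
Proof. exact: reprK. Qed.

Lemma sproj_is_zmod_morphism : zmod_morphism sproj.
Proof.
exact: (raddfB (\pi_(Quotient.quot (GRing.ZmodClosed.clone A rel_ideal _)))).
Qed.

HB.instance Definition _ :=
  GRing.isZmodMorphism.Build A Q sproj sproj_is_zmod_morphism.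

Definition quot_mul (x y : Q) : Q := sproj (repr x * repr y).
Definition quot_scale (q : rat) (x : Q) : Q := sproj (q *: repr x).
Definition quot_sigma (x : Q) : Q := sproj (sigma (repr x)).

Lemma repr_sproj x : repr (sproj x) - x \in rel_ideal.
Proof. by apply/sprojP; rewrite sprojK. Qed.

Lemma quot_mulE x y : quot_mul (sproj x) (sproj y) = sproj (x * y).
Proof.
apply/sprojP; have [_ IB IMl IMr _] := rel_idealP.
have ID a b : a \in rel_ideal -> b \in rel_ideal -> a + b \in rel_ideal.
  exact: rpredD.
rewrite -[X in X - _](subrK (repr (sproj x) * y)) -addrA -mulrBr -mulrBl.
by apply: ID; [apply: IMl; exact: repr_sproj | apply: IMr; exact: repr_sproj].
Qed.

Lemma quot_scaleE q x : quot_scale q (sproj x) = sproj (q *: x).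
Proof.
apply/sprojP; rewrite -scalerBr -[_ *: _]mul1r -scalerAr scalerAl.
exact: sidealMl rel_idealP _ _ (repr_sproj x).
Qed.

Lemma quot_sigmaE x : quot_sigma (sproj x) = sproj (sigma x).
Proof.
apply/sprojP; rewrite -linearB.
exact: sideal_sigma rel_idealP _ (repr_sproj x).
Qed.

Lemma quot_mulA : associative quot_mul.
Proof.
move=> x y z; rewrite -[x]sprojK -[y]sprojK -[z]sprojK.
by rewrite !quot_mulE mulrA.
Qed.

Lemma quot_mul1l : left_id (sproj 1) quot_mul.
Proof. by move=> x; rewrite -[x]sprojK quot_mulE mul1r. Qed.

Lemma quot_mul1r : right_id (sproj 1) quot_mul.
Proof. by move=> x; rewrite -[x]sprojK quot_mulE mulr1. Qed.

Lemma quot_mulDl : left_distributive quot_mul +%R.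
Proof.
move=> x y z; rewrite -[x]sprojK -[y]sprojK -[z]sprojK -raddfD.
by rewrite !quot_mulE -raddfD mulrDl.
Qed.

Lemma quot_mulDr : right_distributive quot_mul +%R.
Proof.
move=> x y z; rewrite -[x]sprojK -[y]sprojK -[z]sprojK -raddfD.
by rewrite !quot_mulE -raddfD mulrDr.
Qed.

Lemma quot_oner_neq0 : sproj 1 != 0.
Proof.
apply/eqP; rewrite -[RHS](raddf0 sproj) => /sprojP; rewrite subr0.
exact/negP.
Qed.

HB.instance Definition _ := GRing.Zmodule_isNzRing.Build Q
  quot_mulA quot_mul1l quot_mul1r quot_mulDl quot_mulDr quot_oner_neq0.

Lemma quot_scaleA q r x : quot_scale q (quot_scale r x) = quot_scale (q * r) x.
Proof. by rewrite -[x]sprojK !quot_scaleE scalerA. Qed.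

Lemma quot_scale1 : left_id 1 quot_scale.
Proof. by move=> x; rewrite -[x]sprojK quot_scaleE scale1r. Qed.

Lemma quot_scaleDr : right_distributive quot_scale +%R.
Proof.
move=> q x y; rewrite -[x]sprojK -[y]sprojK -raddfD.
by rewrite !quot_scaleE -raddfD scalerDr.
Qed.

Lemma quot_scaleDl x : {morph quot_scale^~ x : q r / q + r}.
Proof.
by move=> q r; rewrite -[x]sprojK !quot_scaleE -raddfD scalerDl.
Qed.

HB.instance Definition _ := GRing.Zmodule_isLmodule.Build rat Q
  quot_scaleA quot_scale1 quot_scaleDr quot_scaleDl.

Lemma quot_scaleAl (q : rat) (x y : Q) : q *: (x * y) = (q *: x) * y.
Proof.
rewrite -[x]sprojK -[y]sprojK.
change (quot_scale q (quot_mul (sproj (repr x)) (sproj (repr y))) =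
        quot_mul (quot_scale q (sproj (repr x))) (sproj (repr y))).
by rewrite !(quot_mulE, quot_scaleE) scalerAl.
Qed.

HB.instance Definition _ := GRing.Lmodule_isLalgebra.Build rat Q quot_scaleAl.

Lemma quot_scaleAr (q : rat) (x y : Q) : q *: (x * y) = x * (q *: y).
Proof.
rewrite -[x]sprojK -[y]sprojK.
change (quot_scale q (quot_mul (sproj (repr x)) (sproj (repr y))) =
        quot_mul (sproj (repr x)) (quot_scale q (sproj (repr y)))).
by rewrite !(quot_mulE, quot_scaleE) scalerAr.
Qed.

HB.instance Definition _ := GRing.Lalgebra_isAlgebra.Build rat Q quot_scaleAr.

Lemma sproj_is_monoid_morphism : monoid_morphism sproj.
Proof. by split=> // x y; rewrite -quot_mulE. Qed.

HB.instance Definition _ :=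
  GRing.isMonoidMorphism.Build A Q sproj sproj_is_monoid_morphism.

Lemma sproj_is_scalable : scalable sproj.
Proof. by move=> q x; rewrite -quot_scaleE. Qed.

HB.instance Definition _ :=
  GRing.isScalable.Build rat A Q *:%R sproj sproj_is_scalable.

Lemma quot_sigma_is_linear : linear quot_sigma.
Proof.
move=> q x y; rewrite -[x]sprojK -[y]sprojK -linearZ -raddfD.
by rewrite !quot_sigmaE -linearZ -raddfD linearP.
Qed.

Lemma quot_sigmaM (x y : Q) :
  quot_sigma (x * y) = quot_sigma y * quot_sigma x.
Proof.
by rewrite -[x]sprojK -[y]sprojK -rmorphM !quot_sigmaE -rmorphM sigmaM.
Qed.

Lemma quot_sigmaK : involutive quot_sigma.
Proof. by move=> x; rewrite -[x]sprojK !quot_sigmaE sigmaK. Qed.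

HB.instance Definition _ := isSigmaAlgebra.Build Q
  quot_sigma_is_linear quot_sigmaM quot_sigmaK.

Lemma sproj_sigma : {morph sproj : x / sigma x}.
Proof. by move=> x; rewrite -quot_sigmaE. Qed.

End SigmaQuotient.

(* Sigma-invariant characters with values in Q; they only serve to show that
   the algebras below are nonzero. *)
Definition character (A : sigmaAlgType) (chi : A -> rat) : Prop :=
  [/\ zmod_morphism chi, monoid_morphism chi & forall x, chi (sigma x) = chi x].

Lemma characterD (A : sigmaAlgType) (chi : A -> rat) :
  character chi -> {morph chi : x y / x + y}.
Proof.
move=> [chiB _ _] x y; have chi0 : chi 0 = 0 by rewrite -(subrr 0) chiB subrr.
by rewrite -{1}[y]opprK -[- y]add0r !chiB chi0 sub0r opprK.
Qed.

Lemma characterZ (A : sigmaAlgType) (chi : A -> rat) :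
  character chi -> forall q x, chi (q *: x) = q * chi x.
Proof. by move=> [chiB _ _] q x; exact: (@rat_linear A rat^o). Qed.

Lemma character_consistent (A : sigmaAlgType) (R : A -> A -> Prop)
    (chi : A -> rat) :
  character chi -> (forall a b, R a b -> chi a = chi b) -> consistent R.
Proof.
move=> [chiB [chi1 chiM] chis] chiR; apply/negP => /asboolP.
have chi0 : chi 0 = 0 by rewrite -(subrr 0) chiB subrr.
move=> /(_ (fun x => chi x = 0)); rewrite chi1 => H.
suff /eqP : 1 = 0 :> rat by rewrite oner_eq0.
apply: H; first split=> //.
- by move=> x y x0 y0; rewrite chiB x0 y0 subr0.
- by move=> a x x0; rewrite chiM x0 mulr0.
- by move=> a x x0; rewrite chiM x0 mul0r.
- by move=> x x0; rewrite chis.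
- by move=> a b /chiR ab; rewrite chiB ab subrr.
Qed.

Lemma character_quot (A : sigmaAlgType) (R : A -> A -> Prop)
    (c : consistent R) (chi : A -> rat) :
  character chi -> (forall a b, R a b -> chi a = chi b) ->
  exists2 chi' : sigma_quot c -> rat, character chi' &
    forall x, chi' (sproj c x) = chi x.
Proof.
move=> [chiB [chi1 chiM] chis] chiR.
have chi0 : chi 0 = 0 by rewrite -(subrr 0) chiB subrr.
have kerP x : x \in rel_ideal R -> chi x = 0.
  move=> /asboolP /(_ (fun y => chi y = 0)); apply; first split=> //.
  - by move=> y z y0 z0; rewrite chiB y0 z0 subr0.
  - by move=> a y y0; rewrite chiM y0 mulr0.
  - by move=> a y y0; rewrite chiM y0 mul0r.
  - by move=> y y0; rewrite chis.
  - by move=> a b /chiR ab; rewrite chiB ab subrr.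
pose chi' (x : sigma_quot c) := chi (repr x).
have E x : chi' (sproj c x) = chi x.
  by apply/eqP; rewrite -subr_eq0 -chiB kerP // repr_sproj.
exists chi' => //; split.
- by move=> x y; rewrite -[x]sprojK -[y]sprojK -raddfB !E chiB.
- split; first by rewrite -(rmorph1 (sproj c)) E.
  by move=> x y; rewrite -[x]sprojK -[y]sprojK -rmorphM !E chiM.
- by move=> x; rewrite -[x]sprojK -sproj_sigma !E chis.
Qed.

Lemma character_free (G : involType) (v : G -> rat) :
  (forall g, v (bar g) = v g) ->
  exists2 chi : free_alg G -> rat, character chi & forall g, chi (gen g) = v g.
Proof.
move=> vbar; pose chi : {lrmorphism free_alg G -> rat^o} := @free_lift G rat^o v.
exists chi; last exact: (@free_lift_gen G rat^o v).
split; [exact: (rmorphB chi) | | ].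
  by split; [exact: (rmorph1 chi) | exact: (rmorphM chi)].
move=> x; rewrite /sigma /= free_sigma.unlock (raddf_sum chi) /=.
apply: eq_bigr => m _; rewrite /chi /free_lift mmapU /=; congr (_ * _).
rewrite /word_val /= big_rev /= big_map.
by apply: eq_bigr => g _; rewrite vbar.
Qed.

(* Universal adjunction to A of two-sided inverses of the family u, and of the
   family sigma \o u.  The generators are the elements of A, and for each i
   formal inverses (i, false) of [u i] and (i, true) of [sigma (u i)], swapped
   by the involution.  The relations make A -> localization a homomorphism;
   those for (i, true) are the images under sigma of those for (i, false). *)
Section Localization.
Variables (A : sigmaAlgType) (I : choiceType) (u : I -> A).

Definition loc_gen : Type := (A + I * bool)%type.
HB.instance Definition _ := Choice.on loc_gen.

Definition loc_bar (g : loc_gen) : loc_gen :=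
  match g with
  | inl a => inl (sigma a)
  | inr (i, b) => inr (i, ~~ b)
  end.

Lemma loc_barK : involutive loc_bar.
Proof. by case=> [a|[i b]] /=; rewrite ?sigmaK ?negbK. Qed.

HB.instance Definition _ := hasBar.Build loc_gen loc_barK.

Definition loc_base (a : A) : free_alg loc_gen := gen (inl a : loc_gen).
Definition loc_inv (i : I) : free_alg loc_gen := gen (inr (i, false) : loc_gen).

Variant loc_rel : free_alg loc_gen -> free_alg loc_gen -> Prop :=
| LocAdd a b : loc_rel (loc_base (a + b)) (loc_base a + loc_base b)
| LocScale q a : loc_rel (loc_base (q *: a)) (q *: loc_base a)
| LocMul a b : loc_rel (loc_base (a * b)) (loc_base a * loc_base b)
| LocOne : loc_rel (loc_base 1) 1
| LocMulInv i : loc_rel (loc_base (u i) * loc_inv i) 1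
| LocInvMul i : loc_rel (loc_inv i * loc_base (u i)) 1.

Lemma loc_consistent (chi : A -> rat) :
  character chi -> (forall i, chi (u i) != 0) -> consistent loc_rel.
Proof.
move=> chiC chiu; have [_ [chi1 chiM] chis] := chiC.
pose v (g : loc_gen) : rat :=
  match g with inl a => chi a | inr (i, _) => (chi (u i))^-1 end.
have [|w wC wv] := @character_free loc_gen v.
  by case=> [a|[i b]] //=; rewrite chis.
have [_ [w1 wM] _] := wC.
apply: (character_consistent wC).
have E := (characterD wC, characterZ wC, wM, w1, wv).
have chiE := (characterD chiC, characterZ chiC, chiM, chi1).
by move=> a b [] {a b} => [a b|q a|a b||i|i]; rewrite !E /= ?chiE ?mulfV ?mulVf.
Qed.

Variable c : consistent loc_rel.

Definition localization : Type := sigma_quot c.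
HB.instance Definition _ := SigmaAlgebra.on localization.

Definition loc_in (a : A) : localization := sproj c (loc_base a).

End Localization.

Variant sp_letter := LA | LB | LC | LD.
HB.instance Definition _ := gen_eqMixin sp_letter.
HB.instance Definition _ := gen_choiceMixin sp_letter.

(* (l, true) is the hatted generator. *)
Definition sp_gen : Type := (sp_letter * bool)%type.
HB.instance Definition _ := Choice.on sp_gen.

Definition sp_bar (g : sp_gen) : sp_gen := (g.1, ~~ g.2).

Lemma sp_barK : involutive sp_bar.
Proof. by case=> l b; rewrite /sp_bar /= negbK. Qed.

HB.instance Definition _ := hasBar.Build sp_gen sp_barK.

Definition sp_var (l : sp_letter) : free_alg sp_gen := gen ((l, false) : sp_gen).
Definition sp_hat (l : sp_letter) : free_alg sp_gen := gen ((l, true) : sp_gen).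

Variant sp_rel : free_alg sp_gen -> free_alg sp_gen -> Prop :=
| SpAC : sp_rel (sp_hat LA * sp_var LC) (sp_hat LC * sp_var LA)
| SpAB : sp_rel (sp_var LA * sp_hat LB) (sp_var LB * sp_hat LA)
| SpBD : sp_rel (sp_hat LB * sp_var LD) (sp_hat LD * sp_var LB)
| SpCD : sp_rel (sp_var LC * sp_hat LD) (sp_var LD * sp_hat LC)
| SpDet1 : sp_rel (sp_hat LA * sp_var LD - sp_hat LC * sp_var LB) 1
| SpDet2 : sp_rel (sp_var LA * sp_hat LD - sp_var LB * sp_hat LC) 1.

(* The character (A, B, C, D) |-> (2, 1, 1, 1). *)
Lemma sp_character :
  exists2 chi : free_alg sp_gen -> rat, character chi &
    (forall a b, sp_rel a b -> chi a = chi b) /\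
    (forall l, chi (sp_var l) != 0).
Proof.
pose v (g : sp_gen) : rat := if g.1 is LA then 2 else 1.
have [//|w wC wv] := @character_free sp_gen v.
have [wB [w1 wM] _] := wC.
exists w; first exact: wC.
split; last by case; rewrite wv.
move=> a b [] {a b}; rewrite ?w1; last first.
- by rewrite wB !wM !wv /v /= !mulr1 addrK.
- by rewrite wB !wM !wv /v /= !mulr1 addrK.
all: by rewrite !wM !wv /v /= ?mulr1 ?mul1r.
Qed.

Lemma sp_consistent : consistent sp_rel.
Proof.
by have [w wC [wR _]] := sp_character; exact: (character_consistent wC wR).
Qed.

(* O(SP^sigma(2)) *)
Definition spalg : Type := sigma_quot sp_consistent.
HB.instance Definition _ := SigmaAlgebra.on spalg.

Definition sp_elt (l : sp_letter) : spalg := sproj sp_consistent (sp_var l).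

Lemma sp_loc_consistent : consistent (loc_rel sp_elt).
Proof.
have [w wC [wR w0]] := sp_character.
have [chi chiC chiE] := character_quot sp_consistent wC wR.
by apply: (loc_consistent chiC) => l; rewrite /sp_elt chiE.
Qed.

Definition spalg_loc : Type := localization sp_loc_consistent.
HB.instance Definition _ := SigmaAlgebra.on spalg_loc.

Definition sp_loc (l : sp_letter) : spalg_loc :=
  loc_in sp_loc_consistent (sp_elt l).

(* The vertices 1, 2, 3, 4 of the square are taken in 'Z_4 (so that 4 is 0),
   the cyclic order being given by i |-> i + 1. *)
Definition arc : Type := {p : 'Z_4 * 'Z_4 | p.1 != p.2}.
HB.instance Definition _ := Choice.on arc.

Lemma arc_rev_subproof (a : arc) : (val a).2 != (val a).1.
Proof. by rewrite eq_sym; exact: valP a. Qed.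

Definition arc_rev (a : arc) : arc :=
  exist _ ((val a).2, (val a).1) (arc_rev_subproof a).

Lemma arc_revK : involutive arc_rev.
Proof. by move=> a; apply: val_inj; rewrite /=; case: (val a). Qed.

(* (a, false) stands for the variable of the arc a, (a, true) for its inverse. *)
Definition cl_gen : Type := (arc * bool)%type.
HB.instance Definition _ := Choice.on cl_gen.

Definition cl_bar (g : cl_gen) : cl_gen := (arc_rev g.1, g.2).

Lemma cl_barK : involutive cl_bar.
Proof. by case=> a b; rewrite /cl_bar /= arc_revK. Qed.

HB.instance Definition _ := hasBar.Build cl_gen cl_barK.

Definition cl_var (b : bool) (i j : 'Z_4) : free_alg cl_gen :=
  if insub (i, j) is Some a then gen ((a, b) : cl_gen) else 0.

(* X_ij and its formal inverse; the value 0 given to them when i = j is never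
   used. *)
Definition clX : 'Z_4 -> 'Z_4 -> free_alg cl_gen := cl_var false.
Definition clV : 'Z_4 -> 'Z_4 -> free_alg cl_gen := cl_var true.

(* The noncommutative angle T_i^{jk} *)
Definition cl_angle (i j k : 'Z_4) : free_alg cl_gen :=
  clV j i * clX j k * clV i k.

Variant cl_rel : free_alg cl_gen -> free_alg cl_gen -> Prop :=
| ClMulInv i j : i != j -> cl_rel (clX i j * clV i j) 1
| ClInvMul i j : i != j -> cl_rel (clV i j * clX i j) 1
| ClTriangle i j k : i != j -> j != k -> i != k ->
    cl_rel (cl_angle i j k) (cl_angle i k j)
| ClExchange i j k l : j = i + 1 -> k = i + 2 -> l = i + 3 ->
    cl_rel (clX j l)
           (clX j k * clV i k * clX i l + clX j i * clV k i * clX k l).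

(* The character with X_13 = X_31 = 2 and X_ij = 1 for the other arcs. *)
Definition cl_weight (i j : 'Z_4) : rat :=
  if (i, j) \in [:: (1, 3); (3, 1)] then 2 else 1.

Lemma cl_weightC i j : cl_weight i j = cl_weight j i.
Proof.
rewrite /cl_weight !inE !xpair_eqE.
by rewrite orbC ![(j == _) && _]andbC.
Qed.

Lemma cl_character :
  exists2 chi : free_alg cl_gen -> rat, character chi &
    (forall a b, cl_rel a b -> chi a = chi b) /\
    (forall i j, i != j -> chi (clX i j) = cl_weight i j).
Proof.
pose v (g : cl_gen) : rat :=
  let w := cl_weight (val g.1).1 (val g.1).2 in if g.2 then w^-1 else w.
have [|w wC wv] := @character_free cl_gen v.
  by case=> a b; rewrite /v /= cl_weightC.
have [_ [w1 wM] _] := wC.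
have wX i j : i != j -> w (clX i j) = cl_weight i j.
  by move=> ij; rewrite /clX /cl_var insubT wv.
have wV i j : i != j -> w (clV i j) = (cl_weight i j)^-1.
  by move=> ij; rewrite /clV /cl_var insubT wv.
have w0 i j : cl_weight i j != 0 by rewrite /cl_weight; case: ifP.
exists w; first exact: wC.
split; last exact: wX.
move=> a b [] {a b} => [i j ij|i j ij|i j k ij jk ik|i j k l -> -> ->].
- by rewrite wM wX // wV // w1 mulfV.
- by rewrite wM wX // wV // w1 mulVf.
- rewrite /cl_angle !wM !(wV, wX) // 1?[_ == _]eq_sym //.
  rewrite (cl_weightC j i) (cl_weightC k j) (cl_weightC k i).
  by rewrite mulrAC [RHS]mulrAC [X in X * _]mulrC.
- have ne (p q : 'Z_4) : p != q -> i + p != i + q.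
    by rewrite (inj_eq (addrI i)).
  have ne0 (p : 'Z_4) : p != 0 -> i + p != i.
    by move=> p0; have := ne p 0 p0; rewrite addr0.
  rewrite (characterD wC) !wM !(wX, wV) ?ne ?ne0 // 1?eq_sym ?ne0 //.
  by case: i {ne ne0} => [[|[|[|[|]]]]] //= ilt; rewrite /cl_weight.
Qed.

Lemma cl_consistent : consistent cl_rel.
Proof.
by have [w wC [wR _]] := cl_character; exact: (character_consistent wC wR).
Qed.

Definition square_cluster_alg : Type := sigma_quot cl_consistent.
HB.instance Definition _ := SigmaAlgebra.on square_cluster_alg.

Definition square_var (i j : 'Z_4) : square_cluster_alg :=
  sproj cl_consistent (clX i j).

Variant spec_rel : square_cluster_alg -> square_cluster_alg -> Prop :=
| Spec12 : spec_rel (square_var 1 2) 1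
| Spec21 : spec_rel (square_var 2 1) 1
| Spec34 : spec_rel (square_var 3 4) 1
| Spec43 : spec_rel (square_var 4 3) 1.

Lemma spec_consistent : consistent spec_rel.
Proof.
have [w wC [wR wX]] := cl_character.
have [chi chiC chiE] := character_quot cl_consistent wC wR.
have [_ [chi1 _] _] := chiC.
apply: (character_consistent chiC) => a b [] {a b};
  by rewrite chi1 /square_var chiE wX.
Qed.

Definition square_spec : Type := sigma_quot spec_consistent.
HB.instance Definition _ := SigmaAlgebra.on square_spec.

Definition square_spec_var (i j : 'Z_4) : square_spec :=
  sproj spec_consistent (square_var i j).

(* Main.v *)
Require Import Defs.
From HB Require Import structures.
From mathcomp Require Import all_boot all_order all_algebra.
From mathcomp Require Import generic_quotient finmap monalg boolp.
Import GRing.Theory.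
Local Open Scope ring_scope.

(** Both algebras are given by generators and relations, so mutually inverse
    sigma-algebra maps are obtained by checking that each family of generators
    satisfies the relations of the other.

    Write A, B, C, D for X_13, X_14, X_23, X_24, and A', B', C', D' for the variables
    of the reversed arcs.  Once the sides 12 and 34 are set to 1, each of the
    four triangles has one side equal to 1, and its angle condition becomes a
    relation between the two remaining arcs: triangle 123 gives
    C A^-1 = A'^-1 C', that is A' C = C' A; the triangles 134, 124, 234
    give A B' = B A', B' D = D' B, C D' = D C'.  The exchange relation
    for X_24 becomes D = C A^-1 B + A'^-1, which after multiplication on the left
    by A' reads A' D - C' B = 1; the one for X_42 gives A D' - B C' = 1.
    These are the relations of O(SP^sigma(2)) ([square_sp_matrix]).

    The converse ([sp_matrix_square]) needs all angle conditions and all exchange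
    relations, and here symmetry does the work.  The six angle conditions of a
    triangle are equivalent ([triangle_rot] and symmetry of the condition), so
    one for each triangle is enough.  Given the angle conditions, an exchange
    relation implies the one obtained by rotating the square
    ([exchange_rot]), so the one for X_24 is enough.

    A homomorphism on a localization is determined by its values on the original
    algebra, and one out of the cluster algebra by its values on the X_ij,
    because two-sided inverses are unique; hence the two maps are inverse to each
    other as soon as they are so on A, B, C, D and on the X_ij. *)

Set Implicit Arguments.
Unset Strict Implicit.
Unset Printing Implicit Defensive.

(** * Universal properties of free algebras, quotients and localizations *)

Lemma sigma1 (A : sigmaAlgType) : sigma 1 = 1 :> A.
Proof. by rewrite -[LHS]mulr1 -[X in _ * X]sigmaK -sigmaM mulr1 sigmaK. Qed.

Lemma free_lift_sigma (G : involType) (B : sigmaAlgType) (v : G -> B) :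
    (forall g, v (bar g) = sigma (v g)) ->
  {morph free_lift v : x / sigma x >-> sigma x}.
Proof.
move=> vbar x.
have sigma_prod (s : seq G) :
    sigma (\prod_(g <- s) v g) = \prod_(g <- rev (map bar s)) v g.
  elim: s => [|g s IHs] /=; first by rewrite !big_nil sigma1.
  by rewrite big_cons sigmaM IHs rev_cons -cats1 big_cat big_seq1 vbar.
(* Both sides are now expanded over the words of the support of x. *)
rewrite {1}/sigma /= free_sigma.unlock (raddf_sum (free_lift v)) /=.
rewrite /free_lift [X in sigma X]/mmap (linear_sum (@sigma B)).
apply: eq_bigr => m _ /=; rewrite mmapU /= !mulr_algl linearZ /=.
by rewrite /word_val sigma_prod.
Qed.

Lemma free_alg_hom_ext (G : involType) (B : algType rat)
    (f h : {lrmorphism free_alg G -> B}) :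
  (forall g, f (gen g) = h (gen g)) -> f =1 h.
Proof.
move=> fh x.
have wordE (s : seq G) : \prod_(g <- s) gen g = << FMonom s >> :> free_alg G.
  elim: s => [|g s IHs]; first by rewrite big_nil -fmoneE.
  rewrite big_cons IHs free_mulE /gen free_gen.unlock malgM_def fgmulUU mulr1.
  by rewrite /mmul /= fmmulE fmuE.
rewrite [x]monalgE !(raddf_sum _) /=; apply: eq_bigr => m _.
have -> : << x@_m *g m >> = x@_m *: \prod_(g <- fmonom_val m) gen g
    :> free_alg G.
  rewrite wordE; case: m => s /=.
  by rewrite -[RHS]mul_malgC malgM_def fgmulUU mulr1 mul1m.
rewrite !linearZ /= !rmorph_prod; congr (_ *: _).
by apply: eq_bigr => g _; exact: fh.
Qed.

Section QuotientLift.
Variables (A : sigmaAlgType) (R : A -> A -> Prop) (c : consistent R).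
Variables (B : sigmaAlgType) (f : {lrmorphism A -> B}).
Hypothesis f_sigma : {morph f : x / sigma x >-> sigma x}.
Hypothesis f_rel : forall a b, R a b -> f a = f b.

(** The map induced by [f] on the quotient; [repr] picks a representative, and
    [quot_lift_sproj] shows that the choice does not matter. *)
Definition quot_lift (x : sigma_quot c) : B := f (repr x).

Lemma quot_lift_sproj x : quot_lift (sproj c x) = f x.
Proof.
(* The kernel of f is a sigma-ideal containing the relations. *)
have /asboolP/(_ (fun y => f y = 0)) := repr_sproj c x.
rewrite rmorphB /= => /(_ _ _)/subr0_eq; apply.
  split=> [|y z y0 z0|a y y0|a y y0|y y0].
  - exact: rmorph0.
  - by rewrite /= rmorphB /= y0 z0 subr0.
  - by rewrite /= rmorphM /= y0 mulr0.
  - by rewrite /= rmorphM /= y0 mul0r.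
  - by rewrite /= f_sigma y0 linear0.
by move=> a b /f_rel ab; rewrite rmorphB /= ab subrr.
Qed.

Lemma quot_lift_is_zmod_morphism : zmod_morphism quot_lift.
Proof.
move=> x y; rewrite -[x]sprojK -[y]sprojK -(raddfB (sproj c)).
by rewrite !quot_lift_sproj rmorphB.
Qed.

Lemma quot_lift_is_monoid_morphism : monoid_morphism quot_lift.
Proof.
split=> [|x y]; first by rewrite -(rmorph1 (sproj c)) quot_lift_sproj rmorph1.
rewrite -[x]sprojK -[y]sprojK -(rmorphM (sproj c)).
by rewrite !quot_lift_sproj rmorphM.
Qed.

Lemma quot_lift_is_scalable : scalable quot_lift.
Proof. exact/rat_linear/quot_lift_is_zmod_morphism. Qed.

HB.instance Definition _ := GRing.isZmodMorphism.Build (sigma_quot c) B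
  quot_lift quot_lift_is_zmod_morphism.
HB.instance Definition _ := GRing.isMonoidMorphism.Build (sigma_quot c) B
  quot_lift quot_lift_is_monoid_morphism.
HB.instance Definition _ := GRing.isScalable.Build rat (sigma_quot c) B *:%R
  quot_lift quot_lift_is_scalable.

Lemma quot_lift_exists : exists2 h : {lrmorphism sigma_quot c -> B},
  {morph h : x / sigma x >-> sigma x} & forall x, h (sproj c x) = f x.
Proof.
exists quot_lift => [x|x]; last exact: quot_lift_sproj.
by rewrite /= -[x]sprojK -sproj_sigma !quot_lift_sproj f_sigma.
Qed.

End QuotientLift.

Lemma inverse_uniq (R : pzRingType) (x y z : R) : y * x = 1 -> x * z = 1 -> y = z.
Proof. by move=> yx xz; rewrite -[y]mulr1 -xz mulrA yx mul1r. Qed.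

Section LocalizationMaps.
Variables (A : sigmaAlgType) (I : choiceType) (u : I -> A).
Variable c : consistent (loc_rel u).

Lemma loc_in_is_zmod_morphism : zmod_morphism (loc_in c).
Proof.
have D a b : loc_in c (a + b) = loc_in c a + loc_in c b.
  by rewrite /loc_in (sproj_rel c (LocAdd u a b)) raddfD.
by move=> a b; apply: (@addIr _ (loc_in c b)); rewrite -D !subrK.
Qed.

Lemma loc_in_is_monoid_morphism : monoid_morphism (loc_in c).
Proof.
split=> [|a b]; rewrite /loc_in.
  by rewrite (sproj_rel c (LocOne u)) rmorph1.
by rewrite (sproj_rel c (LocMul u a b)) rmorphM.
Qed.

Lemma loc_in_is_scalable : scalable (loc_in c).
Proof. by move=> q a; rewrite /loc_in (sproj_rel c (LocScale u q a)) linearZ. Qed.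

HB.instance Definition _ := GRing.isZmodMorphism.Build A (localization c)
  (loc_in c) loc_in_is_zmod_morphism.
HB.instance Definition _ := GRing.isMonoidMorphism.Build A (localization c)
  (loc_in c) loc_in_is_monoid_morphism.
HB.instance Definition _ := GRing.isScalable.Build rat A (localization c) *:%R
  (loc_in c) loc_in_is_scalable.

Lemma loc_in_sigma : {morph loc_in c : a / sigma a >-> sigma a}.
Proof. by move=> a; rewrite /loc_in -sproj_sigma sigma_gen. Qed.

Definition loc_inverse (i : I) : localization c := sproj c (loc_inv A i).

Lemma loc_mulV i : loc_in c (u i) * loc_inverse i = 1.
Proof.
rewrite /loc_in /loc_inverse -(rmorphM (sproj c)) /=.
by rewrite (sproj_rel c (LocMulInv u i)) rmorph1.
Qed.

Lemma loc_mulVr i : loc_inverse i * loc_in c (u i) = 1.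
Proof.
rewrite /loc_in /loc_inverse -(rmorphM (sproj c)) /=.
by rewrite (sproj_rel c (LocInvMul u i)) rmorph1.
Qed.

(** It is enough to have inverses of the [f (u i)]: as [f] commutes with
    [sigma], their images under [sigma] are inverses of the
    [f (sigma (u i))]. *)
Lemma loc_lift_exists (B : sigmaAlgType) (f : {lrmorphism A -> B}) (w : I -> B) :
    {morph f : x / sigma x >-> sigma x} ->
    (forall i, f (u i) * w i = 1) -> (forall i, w i * f (u i) = 1) ->
  exists2 h : {lrmorphism localization c -> B},
    {morph h : x / sigma x >-> sigma x} & forall a, h (loc_in c a) = f a.
Proof.
move=> f_sigma fw wf.
pose v (g : loc_gen A I) : B := match g with
  | inl a => f a
  | inr (i, b) => if b then sigma (w i) else w i
  end.
have v_bar g : v (bar g) = sigma (v g).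
  by case: g => [a|[i []]]; rewrite /v /= ?f_sigma ?sigmaK.
have baseE a : free_lift v (loc_base I a) = f a by exact: free_lift_gen.
have invE i : free_lift v (loc_inv A i) = w i by exact: free_lift_gen.
have [||h h_sigma hE] := @quot_lift_exists _ _ c B (free_lift v).
- exact: free_lift_sigma.
- move=> x y [] {x y} => [a b|q a|a b||i|i];
    rewrite ?(rmorphD, rmorphM, rmorph1, linearZ) /= !(baseE, invE) //.
  (* These are the relations saying that A maps homomorphically. *)
  + exact: rmorphD.
  + exact: linearZ.
  + exact: rmorphM.
  + exact: rmorph1.
by exists h => // a; rewrite [LHS]hE; exact: baseE.
Qed.

(** Homomorphisms preserve inverses and inverses are unique, so the values on
    the formal inverses are forced. *)
Lemma loc_hom_ext (B : algType rat) (f h : {lrmorphism localization c -> B}) :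
  (forall a, f (loc_in c a) = h (loc_in c a)) -> f =1 h.
Proof.
move=> fh x; rewrite -[x]sprojK.
pose p : {lrmorphism free_alg (loc_gen A I) -> localization c} := sproj c.
apply: (@free_alg_hom_ext _ _ (f \o p) (h \o p)) => -[a|[i b]] /=.
  exact: fh.
have hom_inv (k : {lrmorphism localization c -> B}) s t :
  s * t = 1 -> k s * k t = 1 by move=> st; rewrite -rmorphM st rmorph1.
pose t : localization c := loc_in c (if b then sigma (u i) else u i).
pose s : localization c := p (gen (inr (i, b) : loc_gen A I)).
rewrite -/s.
have [st ts] : s * t = 1 /\ t * s = 1.
  rewrite /s /t; case: b {s t}.
    2: by rewrite [p _]/(loc_inverse i) loc_mulV loc_mulVr.
  have -> : p (gen (inr (i, true) : loc_gen A I)) = sigma (loc_inverse i).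
    by rewrite /loc_inverse -sproj_sigma sigma_gen.
  by rewrite loc_in_sigma -!sigmaM loc_mulV loc_mulVr sigma1.
apply: (inverse_uniq (x := f t)); first exact: hom_inv.
by rewrite fh; exact: hom_inv.
Qed.

End LocalizationMaps.

(** * The relations of the two presentations in an arbitrary ring *)

Record sp_matrix (R : pzRingType) (e : sp_gen -> R) : Prop := SpMatrix {
  sp_matrixAC : e (LA, true) * e (LC, false) = e (LC, true) * e (LA, false);
  sp_matrixAB : e (LA, false) * e (LB, true) = e (LB, false) * e (LA, true);
  sp_matrixBD : e (LB, true) * e (LD, false) = e (LD, true) * e (LB, false);
  sp_matrixCD : e (LC, false) * e (LD, true) = e (LD, false) * e (LC, true);
  sp_matrix_det1 :
    e (LA, true) * e (LD, false) - e (LC, true) * e (LB, false) = 1;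
  sp_matrix_det2 :
    e (LA, false) * e (LD, true) - e (LB, false) * e (LC, true) = 1
}.

(** Here and below [V i j] stands for the inverse of [X i j]; the equation is
    T_i^{jk} = T_i^{kj}. *)
Definition triangle_cond (R : pzRingType) (X V : 'Z_4 -> 'Z_4 -> R) i j k :=
  V j i * X j k * V i k = V k i * X k j * V i j.

Definition exchange_cond (R : pzRingType) (X V : 'Z_4 -> 'Z_4 -> R) i j k l :=
  X j l = X j k * V i k * X i l + X j i * V k i * X k l.

Definition arc_inverse (R : pzRingType) (X V : 'Z_4 -> 'Z_4 -> R) :=
  forall i j, i != j -> X i j * V i j = 1 /\ V i j * X i j = 1.

Record square_relations (R : pzRingType) (X V : 'Z_4 -> 'Z_4 -> R) : Prop :=
  SquareRelations {
  square_triangle i j k : i != j -> j != k -> i != k -> triangle_cond X V i j k;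
  square_exchange i j k l : j = i + 1 -> k = i + 2 -> l = i + 3 ->
    exchange_cond X V i j k l
}.

(** The vertex 4 of the square is 0 in ['Z_4]. *)
Definition letter_arc (g : sp_gen) : 'Z_4 * 'Z_4 :=
  let a := match g.1 with
           | LA => (1, 3) | LB => (1, 0) | LC => (2, 3) | LD => (2, 0)
           end in
  if g.2 then (a.2, a.1) else a.

Lemma Z4_ind (P : 'Z_4 -> Prop) : P 0 -> P 1 -> P 2 -> P 3 -> forall i, P i.
Proof.
move=> P0 P1 P2 P3 [[|[|[|[|]]]]] //= lti.
- by rewrite (_ : Ordinal lti = 0) //; exact: val_inj.
- by rewrite (_ : Ordinal lti = 1) //; exact: val_inj.
- by rewrite (_ : Ordinal lti = 2) //; exact: val_inj.
- by rewrite (_ : Ordinal lti = 3) //; exact: val_inj.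
Qed.

Section SquareRelations.
Variables (R : pzRingType) (X V : 'Z_4 -> 'Z_4 -> R).
Hypothesis XVinv : arc_inverse X V.

Let XVK i j y : i != j -> y * X i j * V i j = y.
Proof. by move=> /XVinv[XV _]; rewrite -mulrA XV mulr1. Qed.
Let VXK i j y : i != j -> y * V i j * X i j = y.
Proof. by move=> /XVinv[_ VX]; rewrite -mulrA VX mulr1. Qed.
Let XKV i j y : i != j -> X i j * (V i j * y) = y.
Proof. by move=> /XVinv[XV _]; rewrite mulrA XV mul1r. Qed.
Let VKX i j y : i != j -> V i j * (X i j * y) = y.
Proof. by move=> /XVinv[_ VX]; rewrite mulrA VX mul1r. Qed.

(** The condition says that X_ki X_ji^-1 X_jk X_ik^-1 X_ij X_kj^-1 = 1, and
    rotating the triangle conjugates this product cyclically. *)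
Lemma triangle_rot i j k : i != j -> j != k -> i != k ->
  triangle_cond X V i j k -> triangle_cond X V j k i.
Proof.
rewrite /triangle_cond => ij jk ik.
have [ki kj] : k != i /\ k != j by rewrite ![k == _]eq_sym.
move=> /(congr1 (fun z => V k j * (X k i * z) * X i k * V j k)).
by rewrite !mulrA !VXK // XVK // -!mulrA XKV // VKX.
Qed.

Lemma triangles_all :
    triangle_cond X V 1 2 3 -> triangle_cond X V 1 2 0 ->
    triangle_cond X V 3 1 0 -> triangle_cond X V 3 2 0 ->
  forall i j k, i != j -> j != k -> i != k -> triangle_cond X V i j k.
Proof.
move=> T123 T120 T310 T320.
have orders i j k : i != j -> j != k -> i != k -> triangle_cond X V i j k ->
    [/\ triangle_cond X V j k i, triangle_cond X V k i j,
        triangle_cond X V i k j, triangle_cond X V k j i &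
        triangle_cond X V j i k].
  move=> ij jk ik T; have [ki kj] : k != i /\ k != j by rewrite ![k == _]eq_sym.
  have ji : j != i by rewrite eq_sym.
  have T1 := triangle_rot ij jk ik T.
  have T2 : triangle_cond X V k i j by exact: triangle_rot T1.
  by split=> //; exact: esym.
have [] := orders 1 2 3 isT isT isT T123.
have [] := orders 1 2 0 isT isT isT T120.
have [] := orders 3 1 0 isT isT isT T310.
have [] := orders 3 2 0 isT isT isT T320.
(* The 4 * 5 conditions just produced complete the list of ordered triples. *)
do 20!move=> ?.
by elim/Z4_ind; elim/Z4_ind => //; elim/Z4_ind.
Qed.

(** Multiply the relation for X_jl by X_ki X_ji^-1 on the left and by
    X_jl^-1 X_ji on the right: the left side becomes X_ki, and by the angle
    conditions of ijk and ijl the right side becomes the exchange expression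
    for X_ki. *)
Lemma exchange_rot i j k l :
    i != j -> i != k -> i != l -> j != k -> j != l -> k != l ->
    triangle_cond X V i j k -> triangle_cond X V i j l ->
  exchange_cond X V i j k l -> exchange_cond X V j k l i.
Proof.
rewrite /exchange_cond => ij ik il jk jl kl Tijk Tijl Exch.
have [ji ki kj] : [/\ j != i, k != i & k != j].
  by rewrite ![_ == i]eq_sym ![k == _]eq_sym.
have li : l != i by rewrite eq_sym.
have hijk : X k i * V j i * X j k * V i k = X k j * V i j.
  by rewrite -!mulrA (mulrA (V j i)) Tijk -!mulrA XKV.
have hijl : V i j * X i l * V j l * X j i = V l j * X l i.
  by rewrite -(triangle_rot ij jl il Tijl) VXK.
have : X k i * V j i * X j l * V j l * X j i = X k i by rewrite XVK // VXK.
rewrite Exch mulrDr !mulrDl !mulrA hijk VXK // (proj1 (XVinv ki)) mul1r => <-.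
rewrite addrC; congr (_ + _).
by rewrite -!mulrA -hijl !mulrA.
Qed.

Lemma exchanges_all :
    (forall i j k, i != j -> j != k -> i != k -> triangle_cond X V i j k) ->
  exchange_cond X V 1 2 3 0 ->
  forall i j k l, j = i + 1 -> k = i + 2 -> l = i + 3 ->
    exchange_cond X V i j k l.
Proof.
move=> T E1.
have rot i j k l := @exchange_rot i j k l.
have E2 : exchange_cond X V 2 3 0 1 by apply: (rot 1 2 3 0) => //; exact: T.
have E3 : exchange_cond X V 3 0 1 2 by apply: (rot 2 3 0 1) => //; exact: T.
have E0 : exchange_cond X V 0 1 2 3 by apply: (rot 3 0 1 2) => //; exact: T.
(* In ['Z_4] the indices i + 1, ... evaluate to the expected values, but equal
   only propositionally the numerals used above. *)
have shift i j k l : exchange_cond X V i j k l -> val j = val (i + 1) ->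
    val k = val (i + 2) -> val l = val (i + 3) ->
    exchange_cond X V i (i + 1) (i + 2) (i + 3).
  by move=> E /val_inj<- /val_inj<- /val_inj<-.
move=> i _ _ _ -> -> ->.
by elim/Z4_ind: i; [exact: shift E0 _ _ _ | exact: shift E1 _ _ _
                   |exact: shift E2 _ _ _ | exact: shift E3 _ _ _].
Qed.

(** With the sides 12 and 34 equal to 1, four angle conditions and the exchange
    relations for X_24 and X_42 are the six relations of [sp_matrix], up to
    clearing inverses. *)
Lemma square_sp_matrix :
    square_relations X V -> X 1 2 = 1 -> X 2 1 = 1 -> X 3 0 = 1 -> X 0 3 = 1 ->
  sp_matrix (fun g => X (letter_arc g).1 (letter_arc g).2).
Proof.
move=> [T E] X12 X21 X30 X03.
have V1 i j : i != j -> X i j = 1 -> V i j = 1.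
  by move=> /XVinv[+ _] Xij; rewrite Xij mul1r.
have [V12 V21 V30 V03] : [/\ V 1 2 = 1, V 2 1 = 1, V 3 0 = 1 & V 0 3 = 1].
  by split; exact: V1.
(* An angle condition with its unit factors removed is an equality
   y X_ij^-1 = X_kl^-1 z. *)
have cross i j k l y z : i != j -> k != l ->
    y * V i j = V k l * z -> X k l * y = z * X i j.
  move=> ij kl /(congr1 (fun z => X k l * z * X i j)).
  by rewrite !mulrA VXK // (proj1 (XVinv kl)) mul1r.
have AC : X 3 1 * X 2 3 = X 3 2 * X 1 3.
  by apply: cross => //; have := T 1 2 3 isT isT isT;
     rewrite /triangle_cond V12 V21 mul1r mulr1.
have AB : X 1 3 * X 0 1 = X 1 0 * X 3 1.
  by apply: cross => //; have := T 3 0 1 isT isT isT;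
     rewrite /triangle_cond V03 V30 mul1r mulr1.
split=> //=.
- by apply: cross => //; have := T 1 2 0 isT isT isT;
     rewrite /triangle_cond V12 V21 mul1r mulr1.
- by apply: cross => //; have := T 3 0 2 isT isT isT;
     rewrite /triangle_cond V03 V30 mul1r mulr1.
- have -> : X 2 0 = X 2 3 * V 1 3 * X 1 0 + V 3 1.
    have := E 1 2 3 0; rewrite /exchange_cond X21 X30 mul1r mulr1.
    by apply; exact: val_inj.
  by rewrite mulrDr !mulrA AC XVK // addrC addKr (proj1 (XVinv _)).
- have -> : X 0 2 = X 0 1 * V 3 1 * X 3 2 + V 1 3.
    have := E 3 0 1 2; rewrite /exchange_cond X03 X12 mul1r mulr1.
    by apply; exact: val_inj.
  by rewrite mulrDr !mulrA AB XVK // addrC addKr (proj1 (XVinv _)).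
Qed.

End SquareRelations.

(** A partial inverse of [letter_arc]: the sides 12 and 34, specialized to 1,
    carry no letter, which is why the variable of an arc is read off as
    [oapp e 1 (arc_letter i j)]. *)
Definition arc_letter (i j : 'Z_4) : option sp_gen :=
  match val i, val j with
  | 1, 3 => Some (LA, false) | 3, 1 => Some (LA, true)
  | 1, 0 => Some (LB, false) | 0, 1 => Some (LB, true)
  | 2, 3 => Some (LC, false) | 3, 2 => Some (LC, true)
  | 2, 0 => Some (LD, false) | 0, 2 => Some (LD, true)
  | _, _ => None
  end%N.

Lemma arc_letter_inverse (R : pzRingType) (e e' : sp_gen -> R) :
    (forall g, e g * e' g = 1 /\ e' g * e g = 1) ->
  arc_inverse (fun i j => oapp e 1 (arc_letter i j))
              (fun i j => oapp e' 1 (arc_letter i j)).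
Proof.
by move=> ee' i j _; case: (arc_letter i j) => //=; rewrite mulr1.
Qed.

(** Only one angle condition per triangle and one exchange relation have to be
    checked; each of them is a relation of [sp_matrix] divided by suitable
    letters. *)
Lemma sp_matrix_square (R : pzRingType) (e e' : sp_gen -> R) :
    (forall g, e g * e' g = 1 /\ e' g * e g = 1) -> sp_matrix e ->
  square_relations (fun i j => oapp e 1 (arc_letter i j))
                   (fun i j => oapp e' 1 (arc_letter i j)).
Proof.
move=> ee' [AC AB BD CD det1 _].
set X := fun i j : 'Z_4 => oapp e 1 _; set V := fun i j : 'Z_4 => oapp e' 1 _.
have XVinv : arc_inverse X V := arc_letter_inverse ee'.
have cross g h y z : e g * y = z * e h -> y * e' h = e' g * z.
  move=> /(congr1 (fun t => e' g * t * e' h)).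
  rewrite !mulrA (proj2 (ee' g)) mul1r => ->.
  by rewrite -mulrA (proj1 (ee' h)) mulr1.
have T : forall i j k, i != j -> j != k -> i != k -> triangle_cond X V i j k.
  apply: triangles_all => //; rewrite /triangle_cond /X /V /= !(mul1r, mulr1).
  - exact: cross.
  - exact: cross.
  - exact/esym/cross.
  - exact/esym/cross.
split=> //; apply: exchanges_all => //.
rewrite /exchange_cond /X /V /= mul1r mulr1.
(* C A^-1 B + A'^-1 = A'^-1 (C' B + 1) = A'^-1 (A' D), where the prime marks
   the hatted letters *)
rewrite (cross _ _ _ _ AC) -mulrA -[X in _ + X]mulr1 -mulrDr.
by rewrite -det1 addrC subrK mulrA (proj2 (ee' _)) mul1r.
Qed.

(** * The variables of the specialized cluster algebra *)

Definition spec_proj (x : free_alg cl_gen) : square_spec :=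
  sproj spec_consistent (sproj cl_consistent x).
HB.instance Definition _ := GRing.LRMorphism.copy spec_proj
  (sproj spec_consistent \o sproj cl_consistent).

Definition square_spec_inv (i j : 'Z_4) : square_spec := spec_proj (clV i j).

Lemma square_spec_inverse : arc_inverse square_spec_var square_spec_inv.
Proof.
have pE a b : cl_rel a b -> spec_proj a = spec_proj b.
  by move=> ab; rewrite /spec_proj (sproj_rel _ ab).
have pM x y : spec_proj (x * y) = spec_proj x * spec_proj y by exact: rmorphM.
have p1 : spec_proj 1 = 1 by exact: rmorph1.
move=> i j ij; split.
- by have := pE _ _ (ClMulInv ij); rewrite pM p1.
- by have := pE _ _ (ClInvMul ij); rewrite pM p1.
Qed.

Lemma square_spec_relations : square_relations square_spec_var square_spec_inv.
Proof.
have pE a b : cl_rel a b -> spec_proj a = spec_proj b.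
  by move=> ab; rewrite /spec_proj (sproj_rel _ ab).
have pM x y : spec_proj (x * y) = spec_proj x * spec_proj y by exact: rmorphM.
have pD x y : spec_proj (x + y) = spec_proj x + spec_proj y by exact: rmorphD.
split=> [i j k ij jk ik|i j k l ji ki li].
- by have := pE _ _ (ClTriangle ij jk ik); rewrite /cl_angle !pM.
- by have := pE _ _ (ClExchange ji ki li); rewrite pD !pM.
Qed.

Lemma square_spec_sides :
  [/\ square_spec_var 1 2 = 1, square_spec_var 2 1 = 1,
      square_spec_var 3 0 = 1 & square_spec_var 0 3 = 1].
Proof.
have pE a b : spec_rel a b -> sproj spec_consistent a = sproj spec_consistent b.
  exact: sproj_rel.
have p1 : sproj spec_consistent 1 = 1 by exact: rmorph1.
have <- : 4 = 0 :> 'Z_4 by exact: val_inj.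
by split; rewrite -p1; apply: pE; constructor.
Qed.

Lemma sigma_cl_var b i j : sigma (cl_var b i j) = cl_var b j i.
Proof.
rewrite /cl_var; have [->|ij] := eqVneq i j.
  by rewrite insubF /= ?eqxx // linear0.
have ji : j != i by rewrite eq_sym.
rewrite !insubT sigma_gen; congr gen; congr pair; exact: val_inj.
Qed.

Lemma sigma_square_spec_var i j :
  sigma (square_spec_var i j) = square_spec_var j i.
Proof.
by rewrite /square_spec_var /square_var -!sproj_sigma sigma_cl_var.
Qed.

(** * The letters of the localized algebra *)

Definition sp_proj (x : free_alg sp_gen) : spalg_loc :=
  loc_in sp_loc_consistent (sproj sp_consistent x).
HB.instance Definition _ := GRing.LRMorphism.copy sp_proj
  (loc_in sp_loc_consistent \o sproj sp_consistent).

Definition sp_loc_gen (g : sp_gen) : spalg_loc := sp_proj (gen g).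

Definition sp_loc_inv (g : sp_gen) : spalg_loc :=
  if g.2 then sigma (loc_inverse sp_loc_consistent g.1)
  else loc_inverse sp_loc_consistent g.1.

Lemma sp_loc_gen_bar g : sp_loc_gen (bar g) = sigma (sp_loc_gen g).
Proof. by rewrite /sp_loc_gen /sp_proj -loc_in_sigma -sproj_sigma sigma_gen. Qed.

Lemma sp_loc_inv_bar g : sp_loc_inv (bar g) = sigma (sp_loc_inv g).
Proof. by case: g => l []; rewrite /sp_loc_inv //= sigmaK. Qed.

Lemma sp_loc_invP g :
  sp_loc_gen g * sp_loc_inv g = 1 /\ sp_loc_inv g * sp_loc_gen g = 1.
Proof.
have plain l : sp_loc_gen (l, false) * sp_loc_inv (l, false) = 1 /\
               sp_loc_inv (l, false) * sp_loc_gen (l, false) = 1.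
  by split; [exact: loc_mulV | exact: loc_mulVr].
case: g => l []; last exact: plain.
have [gi ig] := plain l.
rewrite -[(l, true)]/(bar ((l, false) : sp_gen)) sp_loc_gen_bar sp_loc_inv_bar.
by rewrite -!sigmaM gi ig sigma1.
Qed.

Lemma sp_loc_matrix : sp_matrix sp_loc_gen.
Proof.
have pE a b : sp_rel a b -> sp_proj a = sp_proj b.
  by move=> ab; rewrite /sp_proj (sproj_rel _ ab).
have pM g h : sp_proj (gen g * gen h) = sp_loc_gen g * sp_loc_gen h.
  exact: rmorphM.
have pB x y : sp_proj (x - y) = sp_proj x - sp_proj y by exact: rmorphB.
have p1 : sp_proj 1 = 1 by exact: rmorph1.
split.
- by have := pE _ _ SpAC; rewrite !pM.
- by have := pE _ _ SpAB; rewrite !pM.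
- by have := pE _ _ SpBD; rewrite !pM.
- by have := pE _ _ SpCD; rewrite !pM.
- by have := pE _ _ SpDet1; rewrite pB !pM p1.
- by have := pE _ _ SpDet2; rewrite pB !pM p1.
Qed.

(** * The two maps and the isomorphism *)

Lemma sp_to_spec : exists2 f : {lrmorphism spalg_loc -> square_spec},
  {morph f : x / sigma x >-> sigma x} &
  forall g, f (sp_loc_gen g) = square_spec_var (letter_arc g).1 (letter_arc g).2.
Proof.
pose v g := square_spec_var (letter_arc g).1 (letter_arc g).2.
have v_bar g : v (bar g) = sigma (v g).
  by rewrite /v sigma_square_spec_var; case: g => [[] []].
have [s12 s21 s30 s03] := square_spec_sides.
have M : sp_matrix v.
  exact: (square_sp_matrix square_spec_inverse square_spec_relations).
have liftM g h : free_lift v (gen g * gen h) = v g * v h.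
  by rewrite rmorphM /= !free_lift_gen.
have [||f1 f1_sigma f1E] := @quot_lift_exists _ _ sp_consistent _ (free_lift v).
- exact: free_lift_sigma.
- case: M => AC AB BD CD det1 det2.
  by move=> x y [] {x y}; rewrite ?(rmorphB, rmorph1) /= !liftM.
have f1gen g : f1 (sproj sp_consistent (gen g)) = v g.
  by rewrite f1E; exact: free_lift_gen.
pose w l := square_spec_inv (letter_arc (l, false)).1 (letter_arc (l, false)).2.
have vw l : v (l, false) * w l = 1 /\ w l * v (l, false) = 1.
  by apply: square_spec_inverse; case: l.
have [||f f_sigma fE] := @loc_lift_exists _ _ _ sp_loc_consistent _ f1 w f1_sigma.
- by move=> l; rewrite [f1 _]f1gen; case: (vw l).
- by move=> l; rewrite [f1 _]f1gen; case: (vw l).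
by exists f => // g; rewrite [LHS]fE f1gen.
Qed.

Lemma spec_to_sp : exists f : {lrmorphism square_spec -> spalg_loc},
  forall i j, i != j ->
    f (square_spec_var i j) = oapp sp_loc_gen 1 (arc_letter i j).
Proof.
pose e (b : bool) := if b then sp_loc_inv else sp_loc_gen.
pose v (g : cl_gen) := oapp (e g.2) 1 (arc_letter (val g.1).1 (val g.1).2).
have letter_rev i j : arc_letter j i = omap bar (arc_letter i j).
  by elim/Z4_ind: i; elim/Z4_ind: j.
have v_bar g : v (bar g) = sigma (v g).
  case: g => a b; rewrite /v /= letter_rev; case: (arc_letter _ _) => [g|] /=.
    by case: b; rewrite /e ?sp_loc_gen_bar ?sp_loc_inv_bar.
  by rewrite sigma1.
have liftE b i j : i != j ->
    free_lift v (cl_var b i j) = oapp (e b) 1 (arc_letter i j).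
  by move=> ij; rewrite /cl_var insubT free_lift_gen.
have inv := arc_letter_inverse sp_loc_invP.
have [T E] := sp_matrix_square sp_loc_invP sp_loc_matrix.
have [||f1 f1_sigma f1E] := @quot_lift_exists _ _ cl_consistent _ (free_lift v).
- exact: free_lift_sigma.
- move=> x y [] {x y} => [i j ij|i j ij|i j k ij jk ik|i j k l ji ki li].
  + by rewrite rmorphM rmorph1 /= !liftE //; case: (inv i j ij).
  + by rewrite rmorphM rmorph1 /= !liftE //; case: (inv i j ij).
  + have [ji [ki kj]] : j != i /\ k != i /\ k != j.
      by do 2?split; rewrite eq_sym.
    by rewrite /cl_angle !rmorphM /= !liftE //; exact: T.
  + have := E i j k l ji ki li.
    have : uniq [:: i; j; k; l] by rewrite ji ki li; elim/Z4_ind: (i).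
    rewrite /= !inE !negb_or => /and4P[/and3P[ij ik il] /andP[jk jl] kl _].
    by rewrite rmorphD !rmorphM /= !liftE // eq_sym.
have f1X i j : i != j ->
    f1 (square_var i j) = oapp sp_loc_gen 1 (arc_letter i j).
  by move=> ij; rewrite [LHS]f1E; exact: liftE.
have [|f f_sigma fE] := @quot_lift_exists _ _ spec_consistent _ f1 f1_sigma.
  by move=> x y [] {x y}; rewrite rmorph1 /= f1X.
by exists f => i j ij; rewrite [LHS]fE f1X.
Qed.

Theorem theorem7p24 :
  exists f : {lrmorphism spalg_loc -> square_spec},
    bijective f /\
    {morph f : x / sigma x >-> sigma x} /\
    f (sp_loc LA) = square_spec_var 1 3 /\
    f (sp_loc LB) = square_spec_var 1 4 /\
    f (sp_loc LC) = square_spec_var 2 3 /\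
    f (sp_loc LD) = square_spec_var 2 4.
Proof.
have [f f_sigma fE] := sp_to_spec.
have [h hE] := spec_to_sp.
have eq40 : 4 = 0 :> 'Z_4 by exact: val_inj.
exists f; split; last first.
  by rewrite eq40; do !split; first exact: f_sigma; exact: (fE (_, false)).
exists h.
- apply: (@loc_hom_ext _ _ _ sp_loc_consistent _ (h \o f) idfun) => a.
  rewrite -[a]sprojK.
  apply: (@free_alg_hom_ext _ _ (h \o (f \o sp_proj)) sp_proj) => g.
  by rewrite /= [f _]fE hE; case: g => [[] []].
- move=> x; rewrite -[x]sprojK -[repr x]sprojK.
  apply: (@free_alg_hom_ext _ _ (f \o (h \o spec_proj)) spec_proj).
  have fhX i j : i != j -> f (h (square_spec_var i j)) = square_spec_var i j.
    have [s12 s21 s30 s03] := square_spec_sides.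
    move=> ij; rewrite hE //.
    by elim/Z4_ind: i ij; elim/Z4_ind: j => // _; rewrite /= ?rmorph1 ?fE.
  move=> [[[i j] ij] b]; rewrite /=.
  have -> : gen ((exist _ (i, j) ij, b) : cl_gen) = cl_var b i j.
    by rewrite /cl_var insubT.
  case: b; last exact: fhX.
  have [XV VX] := square_spec_inverse ij.
  apply: (inverse_uniq (x := square_spec_var i j)) => //.
  by have /= := congr1 (f \o h) VX; rewrite !(rmorphM, rmorph1) /= fhX.
Qed.
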